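(* The following statements hold. (i) Let $w_1,\dots,w_n\in\mathbb R_+$ with $\sum_{i=1}^nw_i=1$. If the distribution functions $F_1,\dots,F_n$ belong to $\mathcal H$, then $\sum_{i=1}^nw_iF_i\in\mathcal H$. (ii) If $X\in\mathcal H$, then $\max(X-c,0)\in\mathcal H$ for every $c\in\mathbb R_{++}$.
   Context: $\mathbb R_+=[0,\infty)$, $\mathbb R_{++}=(0,\infty)$, and $n\ge2$ is an integer. For a distribution function $F$, $\overline F=1-F$. A distribution function $F$ with essential infimum $0$ is inverted concave, written $F\in\mathcal H$, if $x\mapsto\overline F(1/x)$ is concave on $\mathbb R_{++}$. For a random variable $X$ with distribution function $F\in\mathcal H$, one also writes $X\in\mathcal H$. *)

(* Defs.v *)
From HB Require Import structures.
From mathcomp Require Import all_boot all_order all_algebra.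
From mathcomp Require Import all_classical all_reals all_analysis.
From mathcomp Require Import ess_sup_inf measurable_realfun.
Set Implicit Arguments.
Unset Strict Implicit.
Unset Printing Implicit Defensive.
Import Order.TTheory GRing.Theory Num.Theory.
Import numFieldNormedType.Exports.
Local Open Scope classical_set_scope.
Local Open Scope convex_scope.
Local Open Scope ring_scope.

(* Counterpart of the library's [convex_function]. *)
Definition concave_function (R : numFieldType) (E : lmodType R)
    (E' := convex_lmodType E) (D : set E') (f : E' -> R^o) :=
  forall t : {i01 R},
    {in D &, forall x y : E', f x <| t |> f y <= f (x <| t |> y)}.

(* The essential infimum of a distribution function is that of the identity
   under the probability measure it generates on the real line. *)
Definition df_ess_inf (R : realType) (F : cumulativeBounded (0 : R) (1 : R))
    : \bar R :=
  ess_inf (lebesgue_stieltjes_measure F) (fun x : R => x%:E).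

(* A class of plain functions: membership includes being a distribution
   function, that is, nondecreasing, right-continuous, with limits 0 at -oo and
   1 at +oo. *)
Definition inverted_concave (R : realType) : set (R -> R) :=
  [set F | exists G : cumulativeBounded (0 : R) (1 : R),
    [/\ F = G :> (R -> R),
        df_ess_inf G = 0%E &
        @concave_function R R^o `]0, +oo[ (fun x : R => 1 - F (1 / x))]].

Definition inverted_concave_RV (d : measure_display) (T : measurableType d)
    (R : realType) (P : probability T R) (X : {RV P >-> R}) : Prop :=
  inverted_concave (fun x : R => fine (cdf X x)).

Arguments inverted_concave_RV {d T R} P X.

(* Main.v *)
Require Import Defs.
From HB Require Import structures.
From mathcomp Require Import all_boot all_order all_algebra.
From mathcomp Require Import all_classical all_reals all_analysis.
From mathcomp Require Import measurable_realfun ess_sup_inf.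
From mathcomp Require Import ring.
Set Implicit Arguments.
Unset Strict Implicit.
Unset Printing Implicit Defensive.
Import Order.TTheory GRing.Theory Num.Theory.
Import numFieldNormedType.Exports.
Local Open Scope classical_set_scope.
Local Open Scope convex_scope.
Local Open Scope ring_scope.

(** A distribution function [F] has essential infimum 0 exactly when it vanishes
    on the negative half-line and is positive on the positive one
    ([df_ess_inf_eq0P]): the measure of the ray ]-oo, x] is [F x], so [y] is
    almost everywhere a lower bound of the identity iff [F] vanishes before [y].
    Membership in the class thus becomes a list of pointwise conditions on [F]
    ([inverted_concaveP]).

    For mixtures, each of these conditions passes to finite sums with
    nonnegative weights of sum 1; for the shape condition one uses
    1 - \sum_i w_i F_i = \sum_i w_i (1 - F_i) and [concave_function_wsum].

    For the excess over [c], the distribution function of max(X - c, 0) is 0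
    before 0 and is x |-> F (x + c) from 0 on ([cdf_excess]).  Put
    h z = 1 - F (1 / z), which is concave and nondecreasing on the positive
    reals, and g x = 1 / (1 / x + c).  For x > 0 the function to be proved concave is
    1 - F (1 / x + c) = h (g x), and [g] is concave
    ([concave_harmonic_shift]); a nondecreasing concave function of a concave
    function is concave ([concave_function_comp]). *)

(** * The essential infimum of a distribution function *)

Lemma lebesgue_stieltjes_measure_ray (R : realType)
    (G : cumulativeBounded (0 : R) (1 : R)) (x : R) :
  lebesgue_stieltjes_measure G `]-oo, x] = (G x)%:E.
Proof. by rewrite -cdf_lebesgue_stieltjes_id. Qed.

Lemma cumulative01_ge0 (R : realType)
    (G : cumulativeBounded (0 : R) (1 : R)) (x : R) :
  0 <= G x.
Proof. by rewrite -lee_fin -lebesgue_stieltjes_measure_ray. Qed.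

(** The condition on the right says that every ray ]-oo, x] with x < y is null,
    hence, these rays exhausting ]-oo, y[, that the latter is null; [G] may
    still jump at [y]. *)
Lemma le_df_ess_infP (R : realType)
    (G : cumulativeBounded (0 : R) (1 : R)) (y : R) :
  (y%:E <= df_ess_inf G)%E <-> (forall x, x < y -> G x = 0).
Proof.
split=> [/ess_infP[/= N [mN N0 yN]] x xy|G0].
  apply: EFin_inj; rewrite -lebesgue_stieltjes_measure_ray.
  apply: (subset_measure0 _ mN) => //.
  apply: (subset_trans _ yN) => z /=; rewrite in_itv/= => zx.
  by rewrite lee_fin; apply/negP; rewrite -ltNge (le_lt_trans zx).
apply/ess_infP.
have cover : ~` [set z : R | (y%:E <= z%:E)%E] `<=`
    \bigcup_n `]-oo, y - n.+1%:R^-1]%classic.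
  move=> z /= /negP; rewrite lee_fin -ltNge => /ltr_add_invr[n zny].
  by exists n => //=; rewrite in_itv/= lerBrDr ltW.
suff [N [mN N0 UN]] : (lebesgue_stieltjes_measure G).-negligible
    (\bigcup_n `]-oo, y - n.+1%:R^-1]%classic).
  by exists N; split=> //; exact: subset_trans UN.
apply: negligible_bigcup => n.
apply/negligibleP => //.
rewrite [LHS]lebesgue_stieltjes_measure_ray G0//.
by rewrite ltrBlDr ltrDl invr_gt0.
Qed.

Lemma df_ess_inf_eq0P (R : realType) (G : cumulativeBounded (0 : R) (1 : R)) :
  df_ess_inf G = 0%E <->
  (forall x, x < 0 -> G x = 0) /\ (forall x, 0 < x -> 0 < G x).
Proof.
split=> [G0|[Gneg Gpos]].
  split; first by apply/le_df_ess_infP; rewrite G0.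
  move=> x x0; rewrite lt_neqAle cumulative01_ge0 andbT.
  apply/eqP => Gx0.
  suff : (x%:E <= df_ess_inf G)%E by rewrite G0 lee_fin leNgt x0.
  apply/le_df_ess_infP => z zx; apply/eqP; rewrite eq_le cumulative01_ge0 andbT.
  by rewrite [leRHS]Gx0 (cumulative_is_nondecreasing G)// ltW.
apply/eqP; rewrite eq_le; apply/andP; split; last exact/le_df_ess_infP.
rewrite leNgt; apply/negP => G0.
(* A real lower bound is extracted since the essential infimum could
   be +oo. *)
have [y y0 /le_df_ess_infP Gy] : exists2 y : R, 0 < y & (y%:E <= df_ess_inf G)%E.
  case: (df_ess_inf G) G0 => [r| |] //; first by exists r.
  by move=> _; exists 1 => //; exact: leey.
have := Gpos (y / 2); rewrite divr_gt0// Gy ?ltxx => [/(_ isT)//|].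
by rewrite ltr_pdivrMr// ltr_pMr// ltr1n.
Qed.

(** Trades the bundled distribution function for conditions that can be checked
    on [F] itself.  The limit 0 at -oo follows from vanishing on the negative
    half-line. *)
Lemma inverted_concaveP (R : realType) (F : R -> R) :
  inverted_concave F <->
  [/\ {homo F : x y / x <= y},
      forall x, F @ x^'+ --> F x,
      F @ +oo --> (1 : R),
      (forall x, x < 0 -> F x = 0) /\ (forall x, 0 < x -> 0 < F x) &
      @concave_function R R^o `]0, +oo[ (fun x : R => 1 - F (1 / x))].
Proof.
split=> [[G [-> /df_ess_inf_eq0P G0 Gconc]]|[Fnd Frc F1 F0 Fconc]].
  split=> //; [exact: cumulative_is_nondecreasing|
               exact: cumulative_is_right_continuous|exact: cumulativey].
have FNy : F @ -oo --> (0 : R).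
  apply: cvg_near_cst; near=> x; apply: F0.1; near: x; exact: nbhs_ninfty_lt.
pose cF := isCumulative.Build R _ R F Fnd Frc.
pose bF := isCumulativeBounded.Build R 0 1 F FNy F1.
pose G : cumulativeBounded (0 : R) (1 : R) := HB.pack F cF bF.
by exists G; split=> //; apply/df_ess_inf_eq0P.
Unshelve. all: by end_near. Qed.

(** * Operations preserving concavity *)

Lemma concave_function_wsum (R : numFieldType) (E : lmodType R)
    (D : set (convex_lmodType E)) (I : Type) (r : seq I) (w : I -> R)
    (f : I -> convex_lmodType E -> R^o) :
  (forall i, 0 <= w i) -> (forall i, concave_function D (f i)) ->
  concave_function D (fun x => \sum_(i <- r) w i * f i x : R^o).
Proof.
move=> w0 fconc t x y xD yD /=.
rewrite convRE !mulr_sumr -big_split/=; apply: ler_sum => i _.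
have := ler_wpM2l (w0 i) (fconc i t x y xD yD).
by rewrite convRE mulrDr !(mulrCA (w i)).
Qed.

Lemma concave_function_comp (R : numFieldType) (E : lmodType R)
    (A : set (convex_lmodType E)) (D : set (convex_lmodType R^o))
    (g : convex_lmodType E -> R^o) (h : convex_lmodType R^o -> R^o) :
  convex_set A -> convex_set D -> {in A, forall x, g x \in D} ->
  {in D &, {homo h : x y / x <= y :> R >-> x <= y}} ->
  concave_function A g -> concave_function D h ->
  concave_function A (h \o g).
Proof.
move=> Acvx Dcvx gD hnd gconc hconc t x y xA yA /=.
apply: (le_trans (hconc t _ _ (gD _ xA) (gD _ yA))).
by apply: hnd; [apply: Dcvx; exact: gD|apply/gD/Acvx|exact: gconc].
Qed.

Lemma convex_set_pos (R : numFieldType) :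
  convex_set (`]0, +oo[ : set (convex_lmodType R^o)).
Proof.
move=> x y t; rewrite !inE/= !in_itv/= !andbT; exact: convR_gt0.
Qed.

(** The function is x |-> x / (1 + c x); the gap in its concavity inequality is
    an explicit multiple of s (1 - s) (a - b)^2. *)
Lemma concave_harmonic_shift (R : realFieldType) (c : R) : 0 <= c ->
  @concave_function R R^o `]0, +oo[ (fun x : R => 1 / (1 / x + c)).
Proof.
move=> c0 t x y; rewrite !inE/= !in_itv/= !andbT => x0 y0.
have den (u : R) : 0 < u -> 0 < 1 + c * u.
  by move=> u0; rewrite ltr_wpDr// mulr_ge0// ltW.
have gE (u : R) : 0 < u -> 1 / (1 / u + c) = u / (1 + c * u).
  by move=> u0; field; rewrite !gt_eqF// den.
have z0 : 0 < (x : R^o) <| t |> y :> R by exact: convR_gt0.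
rewrite (gE _ x0) (gE _ y0) (gE _ z0).
have s0 : 0 <= t%:num :> R by [].
have s1 : t%:num <= 1 :> R by [].
move: z0; rewrite !convRE /unstable.onem.
have key (a b s : R) : 0 < a -> 0 < b -> 0 <= s -> s <= 1 ->
    0 < s * a + (1 - s) * b ->
    s * (a / (1 + c * a)) + (1 - s) * (b / (1 + c * b)) <=
    (s * a + (1 - s) * b) / (1 + c * (s * a + (1 - s) * b)).
  move=> a0 b0 {}s0 {}s1 z0.
  rewrite -subr_ge0 (_ : _ - _ = c * s * (1 - s) * (a - b) ^+ 2 /
     ((1 + c * a) * (1 + c * b) * (1 + c * (s * a + (1 - s) * b)))).
    by rewrite divr_ge0// !(sqr_ge0, mulr_ge0) ?subr_ge0// ltW ?den.
  by field; rewrite !gt_eqF ?den.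
exact: key.
Qed.

(** * Mixtures and excesses *)

Lemma cdf_excess (d : measure_display) (T : measurableType d) (R : realType)
    (P : probability T R) (X : {RV P >-> R}) (c x : R) :
  cdf (((X \- cst c) \max cst 0) : {RV P >-> R}) x =
  if x < 0 then 0%E else cdf X (x + c).
Proof.
rewrite /cdf /distribution /pushforward; case: ifPn => [x0|].
  rewrite [X in P X](_ : _ = set0) ?measure0// -subset0 => w /=.
  by rewrite in_itv/= ge_max (leNgt 0 x) x0 andbF.
rewrite -leNgt => x0; congr (P _); apply/seteqP; split=> w /=;
  by rewrite !in_itv/= ge_max x0 andbT lerBlDr.
Qed.

Theorem proposition5 (R : realType) :
  (forall (n : nat) (w : 'I_n -> R) (F : 'I_n -> R -> R),
      (2 <= n)%N ->
      (forall i, 0 <= w i) ->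
      \sum_(i < n) w i = 1 ->
      (forall i, inverted_concave (F i)) ->
      inverted_concave (fun x => \sum_(i < n) w i * F i x)) /\
  (forall (d : measure_display) (T : measurableType d) (P : probability T R)
      (X : {RV P >-> R}) (c : R),
      0 < c ->
      inverted_concave_RV P X ->
      inverted_concave_RV P (((X \- cst c) \max cst 0) : {RV P >-> R})).
Proof.
split=> [n w F _ w0 w1 /(_ _)/inverted_concaveP HF|d T P X c c0].
  have [Fnd Frc F1 Fs Fconc] := all_and5 HF.
  (* Serves both for right-continuity and for the limit at +oo. *)
  have cvg_wsum (Q : set_system R) (l : 'I_n -> R) : Filter Q ->
      (forall i, F i @ Q --> l i) ->
      (fun x => \sum_(i < n) w i * F i x) @ Q --> \sum_(i < n) w i * l i.
    move=> FQ Fl; apply: cvg_big => [|i _]; first exact: add_continuous.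
    by apply: cvgM; [exact: cvg_cst|exact: Fl].
  apply/inverted_concaveP; split.
  - move=> x y xy; apply: ler_sum => i _.
    by rewrite ler_wpM2l// Fnd.
  - by move=> x; apply: cvg_wsum => i; exact: Frc.
  - rewrite -w1; under [X in _ --> X]eq_bigr do rewrite -[w _]mulr1.
    by apply: cvg_wsum => i; exact: F1.
  - split=> x x0.
      by rewrite big1// => i _; rewrite (Fs i).1// mulr0.
    have Fge0 i : true -> 0 <= w i * F i x.
      by rewrite mulr_ge0// ltW// (Fs i).2.
    (* Weights of sum 1 cannot all vanish, so some term is positive. *)
    rewrite lt_neqAle sumr_ge0// andbT eq_sym psumr_neq0//.
    have : \sum_(i < n) w i != 0 by rewrite w1 oner_eq0.
    rewrite psumr_neq0// => /hasP[i ir /= wi]; apply/hasP; exists i => //=.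
    by rewrite mulr_gt0// (Fs i).2.
  - have -> : (fun x => 1 - \sum_(i < n) w i * F i (1 / x)) =
        (fun x => \sum_(i < n) w i * (1 - F i (1 / x))).
      apply/funext => x; rewrite -[X in X - _]w1 -sumrB.
      by apply: eq_bigr => i _; rewrite mulrBr mulr1.
    exact: concave_function_wsum.
move=> /inverted_concaveP[Fnd Frc F1 [Fneg Fpos] Fconc].
set Y := ((X \- cst c) \max cst 0 : {RV P >-> R}).
have YE x : fine (cdf Y x) = if x < 0 then 0 else fine (cdf X (x + c)).
  by rewrite cdf_excess; case: ifP.
apply/inverted_concaveP; split.
- by move=> x y xy; rewrite fine_le ?fin_num_measure// cdf_nondecreasing.
- move=> x; apply: fine_cvg.
  by rewrite fineK ?fin_num_measure//; exact: cdf_right_continuous.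
- exact/fine_cvg/cvg_cdfy1.
- split=> x x0; first by rewrite YE x0.
  by rewrite YE [x < 0]lt_gtF// Fpos// addr_gt0.
(* The new function at 1 / x is the old one at 1 / z, for
   z := 1 / (1 / x + c). *)
- pose h x := 1 - fine (cdf X (1 / x)).
  have hconc := concave_function_comp (@convex_set_pos R) (@convex_set_pos R)
    _ _ (concave_harmonic_shift (ltW c0)) Fconc.
  move=> t x y xp yp.
  have E z : z \in `]0, +oo[%classic -> 1 - fine (cdf Y (1 / z)) =
      h (1 / (1 / z + c)).
    rewrite inE/= in_itv/= andbT => z0.
    by rewrite YE lt_gtF ?divr_gt0// /h !div1r invrK.
  rewrite !E//; last exact: convex_set_pos.
  apply: hconc => //.
    move=> z; rewrite !inE/= !in_itv/= !andbT => z0.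
    by rewrite divr_gt0// addr_gt0// divr_gt0.
  move=> u v; rewrite !inE/= !in_itv/= !andbT => u0 v0 uv.
  by rewrite lerD2l lerN2 Fnd// !div1r lef_pV2.
Qed.
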